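(* Let $n\in\mathbb{N}$ with $n\geq 2$, let $m\in\mathbb{N}$ (so $m \ge 1$), let $p\in(1,+\infty)$, and let $\varepsilon_1,\varepsilon_2\in(0,+\infty)$. The unit distance graphs of the layers $L(n,m,p,\varepsilon_1)$ and $L(n,m,p,\varepsilon_2)$ are isomorphic as graphs if and only if $\varepsilon_1=\varepsilon_2$.
   Context: For $n,m\in\mathbb{N}$, $p\in(1,+\infty)$, $\varepsilon\in(0,+\infty)$, the layer $L(n,m,p,\varepsilon)$ is the set $\mathbb{R}^n\times[0,\varepsilon]^m\subset\mathbb{R}^{n+m}$ with the metric induced by the $\ell_p$-norm $\|x\|_p=\big(\sum_j |x_j|^p\big)^{1/p}$ on $\mathbb{R}^{n+m}$. The unit distance graph of a metric space $V$ is the graph with vertex set $V$ in which two vertices are joined by an edge if and only if the distance between them is exactly $1$. *)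

(* Defs.v *)
From mathcomp Require Import all_boot all_order all_algebra.
From mathcomp Require Import boolp classical_sets reals exp.

Set Implicit Arguments.
Unset Strict Implicit.
Unset Printing Implicit Defensive.

Import Order.TTheory GRing.Theory Num.Theory.

Local Open Scope classical_set_scope.
Local Open Scope ring_scope.

Record graph := Graph {
  vertex : Type;
  edge : vertex -> vertex -> Prop }.

Definition graph_isomorphic (G H : graph) : Prop :=
  exists f : vertex G -> vertex H,
    bijective f /\ forall x y : vertex G, edge x y <-> edge (f x) (f y).

Definition unit_distance_graph (R : realType) (V : Type) (d : V -> V -> R) :
  graph := {| vertex := V; edge := fun x y => d x y = 1 |}.

Definition lp_norm (R : realType) (k : nat) (p : R) (x : 'rV[R]_k) : R :=
  (\sum_(j < k) `|x ord0 j| `^ p) `^ p^-1.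

(* The points of R^n x [0, eps]^m : only the last m coordinates are
   constrained. *)
Definition layer (R : realType) (n m : nat) (eps : R) : set 'rV[R]_(n + m) :=
  [set x | forall j : 'I_m, 0 <= x ord0 (rshift n j) <= eps].
Arguments layer {R} n m eps.

(* [layer n m eps] is used here as a type, via the coercion from sets to the
   subtypes of their elements. *)
Definition layer_dist (R : realType) (n m : nat) (p eps : R)
    (x y : layer n m eps) : R :=
  lp_norm p (\val x - \val y).

Definition layer_graph (R : realType) (n m : nat) (p eps : R) : graph :=
  unit_distance_graph (@layer_dist R n m p eps).

Lemma layer_graph_sym (R : realType) (n m : nat) (p eps : R)
    (x y : vertex (layer_graph n m p eps)) : edge x y -> edge y x.
Proof.
rewrite /= /layer_dist /lp_norm => <-; congr (_ `^ _).
by apply: eq_bigr => j _; rewrite !mxE distrC.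
Qed.

Lemma layer_graph_irrefl (R : realType) (n m : nat) (p eps : R)
    (x : vertex (layer_graph n m p eps)) : 0 < p -> ~ edge x x.
Proof.
move=> p0; rewrite /= /layer_dist /lp_norm subrr big1 => [|j _]; last first.
  by rewrite mxE normr0 powR0// gt_eqF.
by rewrite powR0 ?invr_eq0 ?gt_eqF// => /eqP; rewrite eq_sym oner_eq0.
Qed.

(* Main.v *)
Require Import Defs.
From mathcomp Require Import all_boot all_order all_algebra.
From mathcomp Require Import boolp classical_sets reals.
From mathcomp Require Import topology normedtype sequences derive exp.
From mathcomp Require Import ring lra.
Import Order.TTheory GRing.Theory Num.Theory.
Import numFieldNormedType.Exports.
Local Open Scope ring_scope.
Local Open Scope classical_set_scope.

Set Implicit Arguments.
Unset Strict Implicit.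
Unset Printing Implicit Defensive.

(* Let [F] be an isomorphism between the layers of widths [eps1] and [eps2].
   As [n >= 2], any two points at distance at most 2 have a common neighbor
   that is a horizontal translate of their midpoint, and its reflection in the
   midpoint is a common neighbor too. So if the common neighbor is unique, it is
   the midpoint; by strict convexity it is indeed unique at distance 2. Hence
   [F] maps unit-step arithmetic progressions to unit-step arithmetic
   progressions, and the infinite ones are horizontal.
   A pair is at graph distance at most k >= 2 iff its metric distance is at most
   k. So parallel progressions, which stay at bounded distance, have parallel
   images: F (x + v) = F x + A v for all horizontal [v], with [A] additive, and
   |v| <= |A v| (compare k v with A (k v) for large k).
   If the vertical part of x - y is [c] with |c| <= 1, and [a] is horizontal with
   |a|^p = 1 - |c|^p, then [y] is adjacent to y + c + a and y + c - a. Applying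
   [F], convexity gives |A a|^p <= 1 - |c'|^p for the vertical part [c'] of
   F x - F y, hence |c'| <= |c|. Subdividing segments, [F] contracts vertical
   distances globally; the diameters of the two cubes give eps2 <= eps1. *)

(** * Powers of absolute values: continuity and strict convexity *)

Definition abspow (R : realType) (p x : R) : R := `|x| `^ p.

Section Abspow.
Context {R : realType}.
Implicit Types (p x y l : R).

Lemma abspow_ge0 p x : 0 <= abspow p x.
Proof. exact: powR_ge0. Qed.

Lemma abspow0 p : 0 < p -> abspow p 0 = 0.
Proof. by move=> p0; rewrite /abspow normr0 powR0 ?gt_eqF. Qed.

Lemma abspow1 p : abspow p 1 = 1.
Proof. by rewrite /abspow normr1 powR1. Qed.

Lemma abspow_eq0 p x : 0 < p -> abspow p x = 0 -> x = 0.
Proof. by move=> p0 /powR_eq0_eq0 /eqP; rewrite normr_eq0 => /eqP. Qed.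

Lemma abspowN p x : abspow p (- x) = abspow p x.
Proof. by rewrite /abspow normrN. Qed.

Lemma abspowM p x y : abspow p (x * y) = abspow p x * abspow p y.
Proof. by rewrite /abspow normrM powRM. Qed.

Lemma abspowK p x : 0 < p -> abspow p (abspow p^-1 x) = `|x|.
Proof.
move=> p0; rewrite /abspow (ger0_norm (powR_ge0 _ _)) -powRrM mulVf ?gt_eqF//.
by rewrite powRr1.
Qed.

Lemma abspowVK p x : 0 < p -> abspow p^-1 (abspow p x) = `|x|.
Proof. by move=> p0; rewrite -{2}(invrK p) abspowK ?invr_gt0. Qed.

Lemma ler_abspow p x y : 0 < p -> `|x| <= `|y| -> abspow p x <= abspow p y.
Proof. by move=> p0; apply: ge0_ler_powR; rewrite ?nnegrE// ltW. Qed.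

Lemma abspow_continuous p : 0 < p -> continuous (abspow p).
Proof.
move=> p0 x.
have [->|x0] := eqVneq x 0.
  (* For [p < 1] the power is not differentiable at 0, so continuity there is checked by hand with
     delta = e^(1/p). Away from 0 it follows from differentiability. *)
  apply/cvgrPdist_lt => e e0; rewrite abspow0//.
  have d0 : 0 < abspow p^-1 e by rewrite powR_gt0 ?normr_gt0 ?gt_eqF.
  have : \forall t \near (0 : R), `|t| < abspow p^-1 e by exact: nbhs0_lt.
  apply: filterS => t td.
  rewrite sub0r normrN (ger0_norm (abspow_ge0 _ _)) -(gtr0_norm e0).
  by rewrite -(abspowK e p0) gt0_ltr_powR ?nnegrE// (gtr0_norm d0).
suff h : {for `|x : R|, continuous (fun t : R => t `^ p)}.
  exact: (continuous_comp (@norm_continuous _ R x) h).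
apply/differentiable_continuous/derivable1_diffP.
apply: derivable_powR.
by rewrite in_itv/= andbT normr_gt0.
Qed.

(** The graph lies strictly above its tangent at 1 (Bernoulli). For x > 0, x^p = x exp((p - 1) ln x)
    > x (1 + (p - 1) ln x), and x ln x >= x - 1. *)
Lemma abspow_tangent p x : 1 < p -> x != 1 -> 1 + p * (x - 1) < abspow p x.
Proof.
move=> p1 x1; have [x0|x0] := leP x 0.
  have [->|xN] := eqVneq x 0.
    by rewrite abspow0; lra.
  have := abspow_ge0 p x; apply: lt_le_trans.
  by nra.
rewrite /abspow gtr0_norm//.
have -> : x `^ p = x * expR ((p - 1) * ln x).
  rewrite {1}/powR gt_eqF// -{2}(lnK x0) -expRD; congr expR; ring.
have lnx : (p - 1) * ln x != 0.
  by apply: mulf_neq0; rewrite ?ln_eq0// subr_eq0 gt_eqF.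
have := expR_gt1Dx lnx; rewrite -(ltr_pM2l x0); apply: le_lt_trans.
have : ln x^-1 <= x^-1 - 1.
  have := @le_ln1Dx R (x^-1 - 1); rewrite [1 + _]addrC subrK; apply.
  by rewrite ltrBrDr addNr invr_gt0.
rewrite lnV ?posrE// => h.
have {}h : x * - ln x <= 1 - x.
  rewrite -[X in X - x](mulfV (lt0r_neq0 x0)) -[X in _ - X]mulr1 -mulrBr.
  by rewrite ler_pM2l.
by nra.
Qed.

(** By homogeneity, dividing by the mean [m] moves the mean to 1, where the tangent bounds at x / m
    and y / m can be averaged. The first one is strict because x differs from m. If [m = 0], the
    right-hand side is positive. *)
Lemma abspow_strict_convex p l x y : 1 < p -> 0 < l < 1 -> x != y ->
  abspow p (l * x + (1 - l) * y) < l * abspow p x + (1 - l) * abspow p y.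
Proof.
move=> p1 /andP[l0 l1] xy; set m := l * x + (1 - l) * y.
have p0 : 0 < p by lra.
have ax := abspow_ge0 p x; have ay := abspow_ge0 p y.
have [m0|m0] := eqVneq m 0.
  rewrite m0 abspow0//.
  have [/(abspow_eq0 p0) x0|ax0] := eqVneq (abspow p x) 0.
    have [/(abspow_eq0 p0) y0|ay0] := eqVneq (abspow p y) 0.
      by move: xy; rewrite x0 y0 eqxx.
    have : 0 < abspow p y by rewrite lt_neqAle eq_sym ay0.
    by nra.
  have : 0 < abspow p x by rewrite lt_neqAle eq_sym ax0.
  by nra.
have am : 0 < abspow p m.
  by rewrite powR_gt0 ?normr_gt0.
have mE z : abspow p z = abspow p m * abspow p (z / m).
  by rewrite -abspowM mulrCA divff ?mulr1.
have zx : x / m != 1.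
  apply: contra xy => /eqP xm; have {}xm : x = m by rewrite -[RHS]mul1r -xm divfK.
  apply/eqP; have : (1 - l) * (x - y) = 0 by rewrite xm /m; rewrite /m in xm; nra.
  by move/eqP; rewrite mulf_eq0 !subr_eq0 (gt_eqF l1)/= => /eqP.
have tx := abspow_tangent p1 zx.
have ty : 1 + p * (y / m - 1) <= abspow p (y / m).
  have [->|/(abspow_tangent p1)/ltW//] := eqVneq (y / m) 1.
  by rewrite subrr mulr0 addr0 abspow1.
rewrite [abspow p x]mE [abspow p y]mE.
have E : l * (x / m) + (1 - l) * (y / m) = 1.
  by rewrite !mulrA -mulrDl divff.
rewrite -[ltLHS]mulr1 ![_ * (abspow p m * _)]mulrCA -mulrDr ltr_pM2l//.
have h1 : l * (1 + p * (x / m - 1)) < l * abspow p (x / m) by rewrite ltr_pM2l.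
have h2 : (1 - l) * (1 + p * (y / m - 1)) <= (1 - l) * abspow p (y / m).
  by rewrite ler_pM2l ?subr_gt0.
apply: le_lt_trans (ltr_leD h1 h2).
rewrite le_eqVlt; apply/orP; left; apply/eqP.
transitivity (1 + p * (l * (x / m) + (1 - l) * (y / m) - 1)); last by ring.
by rewrite E subrr mulr0 addr0.
Qed.

Lemma abspow_convex p l x y : 1 < p -> 0 < l < 1 ->
  abspow p (l * x + (1 - l) * y) <= l * abspow p x + (1 - l) * abspow p y.
Proof.
move=> p1 l01; have [->|xy] := eqVneq x y; last exact/ltW/abspow_strict_convex.
by rewrite -!mulrDl subrKC !mul1r.
Qed.

End Abspow.

(** * Bisecting a chord in the plane by continuity *)

(** An intermediate value argument. Let a + w run along the sphere of radius T^(1/p) from the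
    direction of -a to that of a. Its reflection a - w starts outside or on the sphere and ends
    inside or on it, so it meets the sphere on the way. *)
Lemma abspow_bisector (R : realType) (p a0 a1 T : R) :
  0 < p -> abspow p a0 + abspow p a1 <= T ->
  exists w0 w1, abspow p (a0 + w0) + abspow p (a1 + w1) = T /\
                abspow p (a0 - w0) + abspow p (a1 - w1) = T.
Proof.
move=> p0 aT; have q0 : 0 < p^-1 by rewrite invr_gt0.
(* For a = 0 every w on the sphere works, as w and -w have the same size. *)
have [aN0|a_neq0] := eqVneq (abspow p a0 + abspow p a1) 0.
  have T0 : 0 <= T by rewrite -aN0.
  move/eqP: aN0; rewrite paddr_eq0 ?abspow_ge0// => /andP[].
  move=> /eqP/(abspow_eq0 p0) -> /eqP/(abspow_eq0 p0) ->.
  exists (abspow p^-1 T), 0; rewrite !add0r !abspowN abspowK//.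
  by rewrite abspow0// addr0 ger0_norm.
(* A path from [- a] to [a] that avoids the origin. *)
pose d0 (t : R) := t * a0 - (1 - t * t) * a1.
pose d1 (t : R) := t * a1 + (1 - t * t) * a0.
pose D t := abspow p (d0 t) + abspow p (d1 t).
pose q t := abspow p^-1 (D t).
pose r := abspow p^-1 T.
(* [H t = 0] means that [w = r d / q - a], with [d = (d0 t, d1 t)], solves the
   problem; [H] is kept free of division by [q]. *)
pose H t := abspow p (2 * a0 * q t - r * d0 t)
          + abspow p (2 * a1 * q t - r * d1 t) - abspow p (r * q t).
have a_gt0 : 0 < abspow p a0 + abspow p a1.
  by rewrite lt_neqAle eq_sym a_neq0 addr_ge0 ?abspow_ge0.
have T_gt0 : 0 < T by exact: lt_le_trans aT.
have rT : abspow p r = T by rewrite abspowK// gtr0_norm.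
have qD t : abspow p (q t) = D t.
  by rewrite abspowK// ger0_norm// addr_ge0 ?abspow_ge0.
have cabs s (f : R -> R) : 0 < s -> continuous f ->
    continuous (fun t => abspow s (f t)).
  move=> s0 cf t; apply: (@continuous_comp _ _ _ f (abspow s)); first exact: cf.
  exact: abspow_continuous.
have cd0 : continuous d0.
  by move=> t; rewrite /d0; apply: cvgB; apply: cvgM; try exact: cvg_cst;
    try exact: cvg_id; apply: cvgB; [exact: cvg_cst|apply: cvgM; exact: cvg_id].
have cd1 : continuous d1.
  by move=> t; rewrite /d1; apply: cvgD; apply: cvgM; try exact: cvg_cst;
    try exact: cvg_id; apply: cvgB; [exact: cvg_cst|apply: cvgM; exact: cvg_id].
have cq : continuous q.
  by apply: (@cabs) => // t; apply: cvgD; apply: (@cabs).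
have cH : continuous H.
  have c2 a (d : R -> R) : continuous d ->
      continuous (fun t => abspow p (2 * a * q t - r * d t)).
    move=> cd; apply: (@cabs) => // t.
    by apply: cvgB; apply: cvgM;
      [exact: cvg_cst|exact: cq|exact: cvg_cst|exact: cd].
  have cr : continuous (fun t => abspow p (r * q t)).
    by apply: (@cabs) => // t; apply: cvgM; [exact: cvg_cst|exact: cq].
  by move=> t; apply: cvgB; [apply: cvgD; [exact: c2|exact: c2]|exact: cr].
have r0 : 0 <= r by exact: abspow_ge0.
have q_ge0 t : 0 <= q t by exact: abspow_ge0.
have qr : abspow p^-1 (abspow p a0 + abspow p a1) <= r.
  by apply: ler_abspow => //; rewrite !gtr0_norm.
(* At [t = -1] the direction is -a and [H] equals ((2q + r)^p - r^p) |a|^p. At [t = 1] the factor 2q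
   + r becomes 2q - r, of modulus at most r because 0 <= q <= r. *)
have HN1 : 0 <= H (-1).
  have E : D (-1) = abspow p a0 + abspow p a1.
    rewrite /D /d0 /d1 -(abspowN p a0) -(abspowN p a1).
    by congr (abspow _ _ + abspow _ _); ring.
  have q1 := q_ge0 (-1).
  rewrite /H [2 * a0 * _ - _](_ : _ = (2 * q (-1) + r) * a0);
    last by rewrite /d0; ring.
  rewrite [2 * a1 * _ - _](_ : _ = (2 * q (-1) + r) * a1);
    last by rewrite /d1; ring.
  rewrite !abspowM -mulrDr -E qD -mulrBl;
  apply: mulr_ge0; last by rewrite addr_ge0 ?abspow_ge0.
  by rewrite subr_ge0 ler_abspow// !ger0_norm//; lra.
have HP1 : H 1 <= 0.
  have E : D 1 = abspow p a0 + abspow p a1.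
    by rewrite /D /d0 /d1; congr (abspow _ _ + abspow _ _); ring.
  have q1 := q_ge0 1.
  have qr1 : q 1 <= r by rewrite /q E.
  rewrite /H [2 * a0 * _ - _](_ : _ = (2 * q 1 - r) * a0);
    last by rewrite /d0; ring.
  rewrite [2 * a1 * _ - _](_ : _ = (2 * q 1 - r) * a1);
    last by rewrite /d1; ring.
  rewrite !abspowM -mulrDr -E qD -mulrBl;
  apply: mulr_le0_ge0; last by rewrite addr_ge0 ?abspow_ge0.
  rewrite subr_le0 ler_abspow// (ger0_norm r0) ler_norml; apply/andP; split; lra.
have [t Ht] : exists t, H t = 0.
  clearbody H; have [|||t _ Ht] := @IVT R H (-1) 1 0; last by exists t.
  - exact: le_trans (lerN10 R) ler01.
  - exact/continuous_subspaceT.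
  - by rewrite ge_min HP1 orbT le_max HN1.
have D0 : D t != 0.
  apply/negP; rewrite paddr_eq0 ?abspow_ge0// => /andP[].
  move=> /eqP/(abspow_eq0 p0) d0t /eqP/(abspow_eq0 p0) d1t.
  move: d0t d1t; rewrite /d0 /d1; set b := 1 - t * t => d0t d1t.
  (* The path is t a + b a', with a' the quarter turn of a, so [d = 0] would give (t^2 + b^2) a = 0.
     Completing the square shows that t^2 + b^2 is positive. *)
  have E0 : (t * t + b * b) * a0 = 0.
    transitivity (t * (t * a0 - b * a1) + b * (t * a1 + b * a0)); first by ring.
    by rewrite d0t d1t !mulr0 addr0.
  have E1 : (t * t + b * b) * a1 = 0.
    transitivity (t * (t * a1 + b * a0) - b * (t * a0 - b * a1)); first by ring.
    by rewrite d0t d1t !mulr0 subr0.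
  have tt : t * t + b * b != 0.
    rewrite [X in X != 0](_ : _ = (t * t - 1 / 2) ^+ 2 + 3 / 4);
      last by rewrite /b; field.
    by rewrite gt_eqF// ltr_wpDl ?sqr_ge0// divr_gt0.
  move/eqP: E0; rewrite mulf_eq0 (negPf tt)/= => /eqP a00.
  move/eqP: E1; rewrite mulf_eq0 (negPf tt)/= => /eqP a10.
  by move: a_neq0; rewrite a00 a10 abspow0// addr0 eqxx.
have qn0 : q t != 0.
  by apply: contra D0 => /eqP qt0; rewrite -qD qt0 abspow0.
have Dq (x y : R) : abspow p x + abspow p y = T * D t ->
    abspow p (x / q t) + abspow p (y / q t) = T.
  move=> E; rewrite !abspowM -mulrDl E -qD -mulrA -abspowM divff//.
  by rewrite abspow1 mulr1.
exists (r * d0 t / q t - a0), (r * d1 t / q t - a1); split.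
  by rewrite !subrKC; apply: (@Dq); rewrite !abspowM -mulrDr rT.
rewrite [a0 - _](_ : _ = (2 * a0 * q t - r * d0 t) / q t); last by field.
rewrite [a1 - _](_ : _ = (2 * a1 * q t - r * d1 t) / q t); last by field.
apply: (@Dq); move/eqP: Ht; rewrite subr_eq0 => /eqP ->.
by rewrite abspowM rT qD.
Qed.

(** * The l_p norm, studied through its p-th power *)

Definition sumpow (R : realType) (k : nat) (p : R) (x : 'rV[R]_k) : R :=
  \sum_(j < k) abspow p (x ord0 j).

Section LpNorm.
Context {R : realType} {k : nat} (p : R) (p1 : 1 < p).
Implicit Types (x y u w : 'rV[R]_k) (c l : R).

Let p0 : 0 < p. Proof. exact: lt_trans p1. Qed.

Lemma sumpow_ge0 x : 0 <= sumpow p x.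
Proof. by apply: sumr_ge0 => j _; exact: abspow_ge0. Qed.

Lemma sumpowZ c x : sumpow p (c *: x) = abspow p c * sumpow p x.
Proof. by rewrite mulr_sumr; apply: eq_bigr => j _; rewrite mxE abspowM. Qed.

Lemma sumpowN x : sumpow p (- x) = sumpow p x.
Proof. by apply: eq_bigr => j _; rewrite mxE abspowN. Qed.

Lemma sumpow_eq0 x : sumpow p x = 0 -> x = 0.
Proof.
move/eqP; rewrite psumr_eq0 => [/allP h|j _]; last exact: abspow_ge0.
apply/rowP => j; rewrite mxE; apply: (abspow_eq0 p0); apply/eqP.
by have := h j; rewrite mem_index_enum => /(_ isT).
Qed.

Lemma sumpow_convex l x y : 0 < l < 1 ->
  sumpow p (l *: x + (1 - l) *: y) <= l * sumpow p x + (1 - l) * sumpow p y.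
Proof.
move=> l01; rewrite !mulr_sumr -big_split/=; apply: ler_sum => j _.
by rewrite !mxE abspow_convex.
Qed.

(** A single coordinate in which x and y differ makes the summed inequality strict. *)
Lemma sumpow_strict_convex l x y : 0 < l < 1 ->
  l * sumpow p x + (1 - l) * sumpow p y <= sumpow p (l *: x + (1 - l) *: y) ->
  x = y.
Proof.
move=> l01 h; apply: contrapT => /eqP xy.
have /existsP[j xyj] : [exists j, x ord0 j != y ord0 j].
  apply: contraT; rewrite negb_exists => /forallP e.
  by case/eqP: xy; apply/rowP => j; move/(_ j)/negPn/eqP : e.
move: h; apply/negP; rewrite -ltNge !mulr_sumr -big_split/=.
rewrite [ltLHS](bigD1 j)//= [ltRHS](bigD1 j)//= ltr_leD ?mxE//.
  exact: abspow_strict_convex.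
by apply: ler_sum => i _; rewrite !mxE abspow_convex.
Qed.

Lemma lp_norm_ge0 x : 0 <= lp_norm p x.
Proof. exact: powR_ge0. Qed.

Lemma abspow_lp_norm x : abspow p (lp_norm p x) = sumpow p x.
Proof.
have -> : lp_norm p x = abspow p^-1 (sumpow p x).
  by rewrite /abspow (ger0_norm (sumpow_ge0 _)).
by rewrite abspowK// ger0_norm// sumpow_ge0.
Qed.

Lemma lp_norm_le x (r : R) : 0 <= r ->
  (lp_norm p x <= r) = (sumpow p x <= abspow p r).
Proof.
move=> r0; rewrite -abspow_lp_norm; apply/idP/idP => h.
  by apply: ler_abspow => //; rewrite !ger0_norm ?lp_norm_ge0.
have : 0 < p^-1 by rewrite invr_gt0.
move/(@ler_abspow _ _ (abspow p (lp_norm p x)) (abspow p r)).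
rewrite !(abspowVK _ p0) !(ger0_norm (abspow_ge0 _ _)) !ger0_norm ?lp_norm_ge0//.
exact.
Qed.

Lemma ler_sumpow x y : lp_norm p x <= lp_norm p y -> sumpow p x <= sumpow p y.
Proof. by rewrite (lp_norm_le x (lp_norm_ge0 y)) abspow_lp_norm. Qed.

Lemma lp_norm_le1 x : (lp_norm p x <= 1) = (sumpow p x <= 1).
Proof. by rewrite lp_norm_le// abspow1. Qed.

Lemma lp_norm_eq1 x : lp_norm p x = 1 <-> sumpow p x = 1.
Proof.
rewrite -abspow_lp_norm; split=> [->|h]; first by rewrite abspow1.
rewrite -[LHS]ger0_norm ?lp_norm_ge0// -(abspowVK _ p0) h.
by rewrite abspow1.
Qed.

Lemma lp_normZ c x : lp_norm p (c *: x) = `|c| * lp_norm p x.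
Proof.
rewrite -[LHS]ger0_norm ?lp_norm_ge0// -(abspowVK (lp_norm p (c *: x)) p0).
by rewrite abspow_lp_norm
  sumpowZ -abspow_lp_norm -abspowM (abspowVK _ p0) normrM (ger0_norm (lp_norm_ge0 _)).
Qed.

Lemma lp_normN x : lp_norm p (- x) = lp_norm p x.
Proof. by rewrite -scaleN1r lp_normZ normrN1 mul1r. Qed.

Lemma lp_norm0 : lp_norm p (0 : 'rV[R]_k) = 0.
Proof. by rewrite -[0 in LHS](scale0r 0) lp_normZ normr0 mul0r. Qed.

Lemma lp_norm_eq0 x : lp_norm p x = 0 -> x = 0.
Proof.
by move=> h; apply: sumpow_eq0; rewrite -abspow_lp_norm h abspow0.
Qed.

Lemma coord_lp_norm x j : `|x ord0 j| <= lp_norm p x.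
Proof.
rewrite -(abspowVK _ p0) -[leRHS]ger0_norm ?lp_norm_ge0// -(abspowVK _ p0).
apply: ler_abspow; rewrite ?invr_gt0// !(ger0_norm (abspow_ge0 _ _)).
rewrite abspow_lp_norm /sumpow (bigD1 j)//= lerDl.
by apply: sumr_ge0 => i _; exact: abspow_ge0.
Qed.

(** Minkowski's inequality from convexity of the unit ball: (x + y) / (a + b) is the combination of
    the unit vectors x / a and y / b with weight a / (a + b). *)
Lemma lp_normD x y : lp_norm p (x + y) <= lp_norm p x + lp_norm p y.
Proof.
have [/lp_norm_eq0->|x0] := eqVneq (lp_norm p x) 0.
  by rewrite add0r lp_norm0 add0r.
have [/lp_norm_eq0->|y0] := eqVneq (lp_norm p y) 0.
  by rewrite addr0 lp_norm0 addr0.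
have : 0 < lp_norm p x by rewrite lt_neqAle eq_sym x0 lp_norm_ge0.
have : 0 < lp_norm p y by rewrite lt_neqAle eq_sym y0 lp_norm_ge0.
move bE : (lp_norm p y) => b; move aE : (lp_norm p x) => a {x0 y0} b0 a0.
have ab0 : 0 < a + b by exact: addr_gt0.
have unit (z : 'rV_k) c : 0 < c -> lp_norm p z = c -> sumpow p (c^-1 *: z) = 1.
  move=> c0 zc; apply/lp_norm_eq1.
  by rewrite lp_normZ zc gtr0_norm ?invr_gt0// mulVf ?gt_eqF.
have l01 : 0 < a / (a + b) < 1.
  by rewrite divr_gt0//= ltr_pdivrMr// mul1r ltrDl.
have := sumpow_convex (a^-1 *: x) (b^-1 *: y) l01.
rewrite !unit// !mulr1 subrKC -lp_norm_le1.
rewrite [X in lp_norm p X](_ : _ = (a + b)^-1 *: (x + y)); last first.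
  rewrite scalerDr !scalerA; congr (_ *: _ + _ *: _); field; apply/andP; split;
    by rewrite gt_eqF.
by rewrite lp_normZ gtr0_norm ?invr_gt0// ler_pdivrMl// mulr1.
Qed.

Lemma lp_norm_rotund x y :
  lp_norm p x = 1 -> lp_norm p y = 1 -> lp_norm p (x + y) = 2 -> x = y.
Proof.
move=> /lp_norm_eq1 x1 /lp_norm_eq1 y1 xy.
have l01 : 0 < (2^-1 : R) < 1 by rewrite invr_gt0 ltr0n/= invf_lt1 ?ltr0n// ltr1n.
apply: (sumpow_strict_convex l01); rewrite x1 y1 !mulr1 subrKC.
have -> : 1 - 2^-1 = 2^-1 :> R by field.
rewrite -scalerDr; have /lp_norm_eq1 -> // : lp_norm p (2^-1 *: (x + y)) = 1.
by rewrite lp_normZ xy ger0_norm ?invr_ge0// mulVf ?pnatr_eq0.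
Qed.

(** Only two coordinates move. The others contribute the fixed amount [S], so the planar bisector
    applies with T = 1 - S. *)
Lemma sumpow_bisector u (i0 i1 : 'I_k) : i0 != i1 -> lp_norm p u <= 1 ->
  exists w, [/\ forall j, j != i0 -> j != i1 -> w ord0 j = 0,
    lp_norm p (u + w) = 1 & lp_norm p (u - w) = 1].
Proof.
rewrite lp_norm_le1 => i01 u1.
have split_sum v : sumpow p v = abspow p (v ord0 i0) + abspow p (v ord0 i1)
    + \sum_(j < k | (j != i0) && (j != i1)) abspow p (v ord0 j).
  by rewrite /sumpow (bigD1 i0)//= (bigD1 i1)//= ?addrA// eq_sym.
pose S := \sum_(j < k | (j != i0) && (j != i1)) abspow p (u ord0 j).
have := @abspow_bisector R p (u ord0 i0) (u ord0 i1) (1 - S) p0.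
rewrite lerBrDr -split_sum => /(_ u1)[w0 [w1 [wP wN]]].
pose w : 'rV[R]_k := \row_j (if j == i0 then w0 else if j == i1 then w1 else 0).
have wj j : j != i0 -> j != i1 -> w ord0 j = 0.
  by move=> /negPf j0 /negPf j1; rewrite mxE j0 j1.
have w0E : w ord0 i0 = w0 by rewrite mxE eqxx.
have w1E : w ord0 i1 = w1 by rewrite mxE eq_sym (negPf i01) eqxx.
exists w; split => //; apply/lp_norm_eq1; rewrite split_sum.
  rewrite !mxE eqxx eq_sym (negPf i01) eqxx wP.
  rewrite (eq_bigr (fun j => abspow p (u ord0 j))) ?subrK// => j /andP[j0 j1].
  by rewrite mxE wj ?addr0.
rewrite !mxE eqxx eq_sym (negPf i01) eqxx wN.
rewrite (eq_bigr (fun j => abspow p (u ord0 j))) ?subrK// => j /andP[j0 j1].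
by rewrite mxE [(- w) _ _]mxE wj ?subr0.
Qed.

End LpNorm.

Ltac rowfield := apply/rowP => ?; rewrite !mxE; (ring || field).

(** * Bounded arithmetic progressions *)

Section Archimedes.
Context {R : realType}.

Lemma le0_of_bounded_mulrn (a C : R) : (forall k, a *+ k <= C) -> a <= 0.
Proof.
move=> h; rewrite leNgt; apply/negP => a0.
have C0 : 0 <= C by have := h 0; rewrite mulr0n.
have := archi_boundP (divr_ge0 C0 (ltW a0)).
rewrite ltr_pdivrMr// mulrC mulr_natr => /lt_le_trans/(_ (h _)).
by rewrite ltxx.
Qed.

(** It turns bounds that are uniform along a progression into exact identities: images of
    progressions have no vertical drift, and parallel ones get equal steps. *)
Lemma eq0_of_bounded_progression (a b C : R) :
  (forall k, `|a + b *+ k| <= C) -> b = 0.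
Proof.
move=> h; apply/eqP; rewrite -normr_le0.
apply: (@le0_of_bounded_mulrn _ (C + `|a|)) => k.
rewrite -normrMn -[b *+ k](addKr a) [- a + _]addrC.
by apply: le_trans (ler_normB _ _) _; rewrite lerD2r.
Qed.

End Archimedes.

(** * Horizontal and vertical parts, and walks in the layer *)

Section Layer.
Context {R : realType} {n m : nat}.
Implicit Types (x y z u v w : 'rV[R]_(n + m)) (eps : R).

Definition horizontal v := forall j : 'I_m, v ord0 (rshift n j) = 0.

(** The vertical part remains in the ambient space, so that one norm serves for both parts. *)
Definition vert v : 'rV[R]_(n + m) := row_mx 0 (rsubmx v).

Lemma horizontal0 : horizontal 0.
Proof. by move=> j; rewrite mxE. Qed.

Lemma horizontalD u v : horizontal u -> horizontal v -> horizontal (u + v).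
Proof. by move=> hu hv j; rewrite mxE hu hv addr0. Qed.

Lemma horizontalZ c v : horizontal v -> horizontal (c *: v).
Proof. by move=> hv j; rewrite mxE hv mulr0. Qed.

Lemma horizontalN v : horizontal v -> horizontal (- v).
Proof. by rewrite -scaleN1r; exact: horizontalZ. Qed.

Lemma horizontalB u v : horizontal u -> horizontal v -> horizontal (u - v).
Proof. by move=> hu /horizontalN; exact: horizontalD. Qed.

Lemma horizontalMn v k : horizontal v -> horizontal (v *+ k).
Proof. by rewrite -scaler_nat; exact: horizontalZ. Qed.

Lemma vertE v (j : 'I_m) : vert v ord0 (rshift n j) = v ord0 (rshift n j).
Proof. by rewrite row_mxEr mxE. Qed.

Lemma vertD u v : vert (u + v) = vert u + vert v.
Proof. by rewrite /vert linearD add_row_mx addr0. Qed.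

Lemma vertZ c v : vert (c *: v) = c *: vert v.
Proof. by rewrite /vert linearZ scale_row_mx scaler0. Qed.

Lemma vert_horizontal v : horizontal v -> vert v = 0.
Proof.
move=> hv; rewrite /vert; have -> : rsubmx v = 0; last exact: row_mx0.
by apply/rowP => j; rewrite !mxE hv.
Qed.

Lemma horizontalB_vert v : horizontal (v - vert v).
Proof. by move=> j; rewrite 2!mxE vertE subrr. Qed.

Lemma sumpow_vert (p : R) v : 0 < p ->
  sumpow p (vert v) = \sum_(j < m) abspow p (v ord0 (rshift n j)).
Proof.
move=> p0; rewrite /sumpow big_split_ord/= big1 ?add0r => [|j _]; last first.
  by rewrite row_mxEl mxE abspow0.
by apply: eq_bigr => j _; rewrite vertE.
Qed.

(** The l_p form of Pythagoras: the two vectors have disjoint supports. *)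
Lemma sumpowD_vert (p : R) u v : 0 < p -> horizontal u ->
  sumpow p (u + vert v) = sumpow p u + sumpow p (vert v).
Proof.
move=> p0 hu; rewrite sumpow_vert// /sumpow !big_split_ord/=.
rewrite [X in _ = _ + X + _]big1 ?addr0 => [|j _]; last by rewrite hu abspow0.
congr (_ + _); apply: eq_bigr => j _; rewrite mxE.
  by rewrite row_mxEl mxE addr0.
by rewrite hu add0r vertE.
Qed.

Lemma layerD eps x v : layer n m eps x -> horizontal v -> layer n m eps (x + v).
Proof. by move=> xL hv j; rewrite mxE hv addr0; exact: xL. Qed.

Lemma layer_convex eps x y l : 0 <= l <= 1 ->
  layer n m eps x -> layer n m eps y -> layer n m eps (l *: x + (1 - l) *: y).
Proof.
move=> /andP[l0 l1] xL yL j; have /andP[x0 x1] := xL j; have /andP[y0 y1] := yL j.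
by rewrite !mxE; apply/andP; split; nra.
Qed.

Context {p : R} (hn : (2 <= n)%N) (hp : 1 < p).

(** Here [2 <= n] enters: the first two coordinates are horizontal, and moving them never leaves the
    layer. *)
Lemma horizontal_bisector u : lp_norm p u <= 1 ->
  exists w, [/\ horizontal w, lp_norm p (u + w) = 1 & lp_norm p (u - w) = 1].
Proof.
pose i0 : 'I_(n + m) := lshift m (Ordinal (ltnW hn)).
pose i1 : 'I_(n + m) := lshift m (Ordinal hn).
have i01 : i0 != i1 by rewrite -val_eqE.
move=> /(sumpow_bisector hp i01)[w [wj wP wN]]; exists w; split => // j.
by apply: wj; rewrite eq_rlshift.
Qed.

Lemma horizontal_unit : exists e, horizontal e /\ lp_norm p e = 1.
Proof.
have [|w [hw]] := @horizontal_bisector 0; first by rewrite lp_norm0 ?ler01.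
by rewrite add0r; exists w.
Qed.

(** Walks of length exactly [k]. Every vertex after the first is required to lie in [S]; membership
    of the start is left to the lemmas. *)
Fixpoint walk (S : set 'rV[R]_(n + m)) k x y : Prop :=
  if k is k'.+1 then exists z, [/\ S z, lp_norm p (x - z) = 1 & walk S k' z y]
  else x = y.

Lemma walk_le S k x y : walk S k x y -> lp_norm p (x - y) <= k%:R.
Proof.
elim: k x => [|k IH] x /=; first by move=> ->; rewrite subrr lp_norm0.
case=> z [_ xz /IH zy]; rewrite -(subrKA z) -natr1 addrC.
by apply: le_trans (lp_normD _ _ _) _; rewrite ?lerD ?xz.
Qed.

Lemma walk_map (S S' : set 'rV[R]_(n + m))
    (F : 'rV[R]_(n + m) -> 'rV[R]_(n + m)) k x y :
  (forall z, S z -> S' (F z)) ->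
  (forall z z', S z -> S z' -> lp_norm p (z - z') = 1 ->
     lp_norm p (F z - F z') = 1) ->
  S x -> walk S k x y -> walk S' k (F x) (F y).
Proof.
move=> FS FE; elim: k x => [|k IH] x Sx /=; first by move=> ->.
by case=> z [Sz xz zy]; exists (F z); split; [exact: FS|exact: FE|exact: IH].
Qed.

(** Two steps go through a bisecting point above or beside the midpoint. A longer walk begins with a
    unit step towards y, or with any horizontal unit step if y is closer than 1. Lengths start at 2
    because nearby points need not be adjacent. *)
Lemma layer_walk eps k x y : layer n m eps x -> layer n m eps y ->
  lp_norm p (x - y) <= k.+2%:R -> walk (layer n m eps) k.+2 x y.
Proof.
elim: k x => [|k IH] x xL yL xy.
  have [|w [hw wP wN]] := @horizontal_bisector (2^-1 *: (x - y)).
    by rewrite lp_normZ// ger0_norm ?invr_ge0// ler_pdivrMl// mulr1.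
  have h01 : 0 <= (2^-1 : R) <= 1 by rewrite invr_ge0 ler0n invf_le1 ?ltr0n// ler1n.
  exists (2^-1 *: x + (1 - 2^-1) *: y + w); split.
  - exact: layerD (layer_convex h01 xL yL) hw.
  - by rewrite -[RHS]wN; congr lp_norm; rowfield.
  exists y; split; [exact: yL| |by []].
  by rewrite -[RHS]wP; congr lp_norm; rowfield.
have [r1|r1] := leP 1 (lp_norm p (x - y)).
  move rE : (lp_norm p (x - y)) => r in xy r1.
  have r0 : 0 < r by exact: lt_le_trans r1.
  have rV : 0 <= r^-1 <= 1 by rewrite invr_ge0 ltW//= invf_le1.
  exists (r^-1 *: y + (1 - r^-1) *: x).
  have zL : layer n m eps (r^-1 *: y + (1 - r^-1) *: x)
    by exact: layer_convex rV yL xL.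
  split; first exact: zL.
    transitivity (lp_norm p (r^-1 *: (x - y))).
      by congr lp_norm; rowfield.
    by rewrite lp_normZ// rE gtr0_norm ?invr_gt0// mulVf ?gt_eqF.
  apply: IH; [exact: zL|exact: yL|].
  have -> : r^-1 *: y + (1 - r^-1) *: x - y = (1 - r^-1) *: (x - y).
    by rowfield.
  rewrite lp_normZ// rE ger0_norm; last by case/andP: rV; rewrite subr_ge0.
  by rewrite mulrBl mul1r mulVf ?gt_eqF// lerBlDr natr1.
(* After this step the distance to y is still below 2, within reach of the [k.+2] remaining
   steps. *)
have [e [he e1]] := horizontal_unit.
exists (x + e); split; first exact: layerD xL he.
  by rewrite opprD addNKr lp_normN.
apply: IH; [exact: layerD xL he|exact: yL|].
rewrite addrAC; apply: le_trans (lp_normD hp _ _) _.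
by rewrite e1 -natr1 lerD// (le_trans (ltW r1))// ler1n.
Qed.

End Layer.

(** * Vector identities about midpoints *)

Section Midpoint.
Context {R : realType} {k : nat}.
Implicit Types (x u z w : 'rV[R]_k).

Lemma eq_midpoint x u z : z - x = x + u + u - z -> z = x + u.
Proof.
by move=> /rowP e; apply/rowP => j; move/(_ j): e; rewrite !mxE; lra.
Qed.

Lemma reflect_midpoint x u z w :
  2^-1 *: x + (1 - 2^-1) *: u + w = z -> 2^-1 *: x + (1 - 2^-1) *: u - w = z ->
  u = z + (z - x).
Proof.
move=> /rowP e /rowP f; apply/rowP => j.
by move/(_ j): e; move/(_ j): f; rewrite !mxE; lra.
Qed.

Lemma midpoint_reflections u w :
  2^-1 *: (u + w) + (1 - 2^-1) *: (w - u) = w.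
Proof. by rowfield. Qed.

End Midpoint.

(** * Rigidity of unit-preserving bijections between layers *)

Section UnitPreserving.
Context {R : realType} {n m : nat} {p eps1 eps2 : R}.
Context (hn : (2 <= n)%N) (hp : 1 < p).
Local Notation V := 'rV[R]_(n + m).
Local Notation L1 := (layer n m eps1).
Local Notation L2 := (layer n m eps2).
Context {F G : V -> V}.
Context (FL : forall x, L1 x -> L2 (F x)) (GL : forall x, L2 x -> L1 (G x)).
Context (FK : forall x, L1 x -> G (F x) = x) (GK : forall x, L2 x -> F (G x) = x).
Context (F1 : forall x y, L1 x -> L1 y ->
  lp_norm p (x - y) = 1 -> lp_norm p (F x - F y) = 1).
Context (G1 : forall x y, L2 x -> L2 y ->
  lp_norm p (x - y) = 1 -> lp_norm p (G x - G y) = 1).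
Implicit Types (x y z u v w : V).

Local Opaque lp_norm sumpow vert layer.

Let p0 : 0 < p. Proof. exact: lt_trans hp. Qed.

(** [G] pulls z back to a common neighbor of x and x + 2u. These are at distance 2, so rotundity of
    the norm makes it their midpoint. *)
Lemma unique_common_neighbor x u z : L1 x -> horizontal u -> lp_norm p u = 1 ->
  L2 z -> lp_norm p (z - F x) = 1 -> lp_norm p (F (x + u + u) - z) = 1 ->
  z = F (x + u).
Proof.
move=> xL hu u1 zL zx zxuu.
have xuL : L1 (x + u) by exact: layerD.
have xuuL : L1 (x + u + u) by exact: layerD.
have a1 : lp_norm p (G z - x) = 1 by rewrite -[in LHS](FK xL); exact: G1 (FL xL) zx.
have b1 : lp_norm p (x + u + u - G z) = 1.
  by rewrite -[in LHS](FK xuuL); exact: G1 (FL xuuL) zL zxuu.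
have ab : G z - x = x + u + u - G z.
  apply: (lp_norm_rotund hp a1 b1).
  transitivity (lp_norm p (2 *: u)); first by congr lp_norm; rowfield.
  by rewrite lp_normZ// u1 mulr1 ger0_norm.
by rewrite -[LHS](GK zL) (eq_midpoint ab).
Qed.

Lemma progression x u : L1 x -> horizontal u -> lp_norm p u = 1 ->
  F (x + u + u) = F (x + u) + (F (x + u) - F x).
Proof.
move=> xL hu u1.
have xuL : L1 (x + u) by exact: layerD.
have xuuL : L1 (x + u + u) by exact: layerD.
have unique z := @unique_common_neighbor x u z xL hu u1.
have e1 : lp_norm p (F (x + u) - F x) = 1.
  by apply: F1 xuL xL _; rewrite addrAC subrr add0r.
have e2 : lp_norm p (F (x + u + u) - F (x + u)) = 1.
  by apply: F1 xuuL xuL _; rewrite addrAC subrr add0r.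
have half01 : 0 <= (2^-1 : R) <= 1 by rewrite invr_ge0 ler0n invf_le1 ?ltr0n// ler1n.
have ML := layer_convex half01 (FL xL) (FL xuuL).
move: (FL xL) (FL xuuL) e1 e2 ML unique.
move: (F x) (F (x + u)) (F (x + u + u)) => P Z Q PL QL e1 e2 ML unique.
(* P and Q are at distance at most 2, so M + w and M - w, with M their midpoint, are both common
   neighbors. Uniqueness identifies both with Z, hence Z = M. *)
have [|w [hw wP wN]] := @horizontal_bisector _ n m p hn hp (2^-1 *: (Q - P)).
  rewrite lp_normZ// ger0_norm ?invr_ge0// ler_pdivrMl// mulr1.
  by rewrite -(subrKA Z) (le_trans (lp_normD hp _ _))// e1 e2.
have wZ := unique _ (layerD ML hw).
have NwZ := unique _ (layerD ML (horizontalN hw)).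
have {}wZ : 2^-1 *: P + (1 - 2^-1) *: Q + w = Z.
  apply: wZ.
    by rewrite -[RHS]wP; congr lp_norm; rowfield.
  by rewrite -[RHS]wN; congr lp_norm; rowfield.
have {}NwZ : 2^-1 *: P + (1 - 2^-1) *: Q - w = Z.
  apply: NwZ.
    by rewrite -[RHS]wN; congr lp_norm; rowfield.
  by rewrite -[RHS]wP; congr lp_norm; rowfield.
exact: reflect_midpoint wZ NwZ.
Qed.

Lemma progression_mulrn x u k : L1 x -> horizontal u -> lp_norm p u = 1 ->
  F (x + u *+ k) = F x + (F (x + u) - F x) *+ k.
Proof.
elim: k x => [|k IH] x xL hu u1; first by rewrite !mulr0n !addr0.
rewrite mulrS addrA IH//; last exact: layerD.
by rewrite progression// addrAC subrr add0r mulrS addrA subrKC.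
Qed.

(** The image of the whole progression stays in a layer of width [eps2], so its step has no vertical
    component. *)
Lemma progression_horizontal x u : L1 x -> horizontal u -> lp_norm p u = 1 ->
  horizontal (F (x + u) - F x).
Proof.
move=> xL hu u1 j;
apply: (@eq0_of_bounded_progression _ (F x ord0 (rshift n j)) _ eps2) => k.
have kL : L1 (x + u *+ k) by apply: layerD => //; exact: horizontalMn.
have := FL kL j; rewrite progression_mulrn// mxE mulmxnE => /andP[h1 h2].
by rewrite ger0_norm.
Qed.

Lemma lp_distF k x y : L1 x -> L1 y -> lp_norm p (x - y) <= k.+2%:R ->
  lp_norm p (F x - F y) <= k.+2%:R.
Proof.
move=> xL yL /(layer_walk hn hp xL yL)/(walk_map FL F1 xL).
exact: walk_le.
Qed.

Lemma lp_distF_inv k x y : L1 x -> L1 y -> lp_norm p (F x - F y) <= k.+2%:R ->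
  lp_norm p (x - y) <= k.+2%:R.
Proof.
move=> xL yL /(layer_walk hn hp (FL xL) (FL yL))/(walk_map GL G1 (FL xL)).
by rewrite !FK//; exact: walk_le.
Qed.

(** The displacement shared by all base points is A v in the overview. Comparing two base points
    avoids choosing one to define A. *)
Definition rigid v := forall x y, L1 x -> L1 y ->
  F (x + v) - F x = F (y + v) - F y /\ horizontal (F (x + v) - F x).

(** The progressions from x and y with step u keep a constant distance, so their images stay within
    [K.+2] of each other. The difference of the images is itself a progression, hence has step 0. *)
Lemma rigid_unit u : horizontal u -> lp_norm p u = 1 -> rigid u.
Proof.
move=> hu u1 x y xL yL; split; last exact: progression_horizontal.
apply/eqP; rewrite -subr_eq0; apply/eqP/rowP => j; rewrite [RHS]mxE.
pose K := Num.truncn (lp_norm p (x - y)).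
have xyK : lp_norm p (x - y) <= K.+2%:R.
  rewrite (le_trans (ltW (truncnS_gt _)))// ler_nat; exact: leqnSn.
apply: (@eq0_of_bounded_progression _ ((F x - F y) ord0 j) _ K.+2%:R) => k.
have kL z : L1 z -> L1 (z + u *+ k).
  by move=> zL; apply: layerD zL _; exact: horizontalMn.
have := lp_distF (kL _ xL) (kL _ yL).
rewrite opprD addrACA subrr addr0 => /(_ _ xyK).
rewrite !progression_mulrn//; apply: le_trans.
apply: le_trans (coord_lp_norm hp _ j).
rewrite le_eqVlt; apply/orP; left; apply/eqP; congr `|_|.
by rewrite [in RHS]opprD [in RHS]addrACA -mulrnBl [RHS]mxE mulmxnE.
Qed.

Lemma rigidD u v : horizontal u -> rigid u -> rigid v -> rigid (u + v).
Proof.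
move=> hu ru rv x y xL yL.
have E z : F (z + (u + v)) - F z = (F (z + u + v) - F (z + u)) + (F (z + u) - F z).
  by rewrite subrKA addrA.
have [ruxy hux] := ru x y xL yL.
have [rvxy hvx] := rv (x + u) (y + u) (layerD xL hu) (layerD yL hu).
by rewrite !E; split; [rewrite ruxy rvxy|exact: horizontalD].
Qed.

Lemma rigidMn v k : horizontal v -> rigid v -> rigid (v *+ k).
Proof.
move=> hv rv; elim: k => [x y xL yL|k IH].
  by rewrite mulr0n !addr0 !subrr; split => //; exact: horizontal0.
by rewrite mulrS; exact: rigidD.
Qed.

(** With u = v / (2K) of norm at most 1, the bisector gives unit vectors u + w and u - w of sum v /
    K. Additivity then passes rigidity from unit vectors to v. *)
Lemma rigid_horizontal v : horizontal v -> rigid v.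
Proof.
move=> hv; pose K := (Num.truncn (lp_norm p v)).+1.
have K0 : 0 < 2 * K%:R :> R by rewrite mulr_gt0// ltr0n.
pose u := (2 * K%:R)^-1 *: v.
have hu : horizontal u by exact: horizontalZ.
have [|w [hw wP wN]] := @horizontal_bisector _ n m p hn hp u.
  rewrite lp_normZ// gtr0_norm ?invr_gt0// ler_pdivrMl// mulr1.
  rewrite (le_trans (ltW (truncnS_gt _)))// ler_peMl ?ler0n// ler1n//.
have -> : v = ((u + w) + (u - w)) *+ K.
  rewrite addrACA subrr addr0 -mulr2n -mulrnA -scaler_nat /u scalerA natrM.
  by rewrite mulfV ?gt_eqF// scale1r.
have hP := horizontalD hu hw; have hN := horizontalB hu hw.
exact: rigidMn (horizontalD hP hN)
  (rigidD hP (rigid_unit hP wP) (rigid_unit hN wN)).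
Qed.

Lemma rigid_iter x v k : L1 x -> horizontal v ->
  F (x + v *+ k) = F x + (F (x + v) - F x) *+ k.
Proof.
move=> xL hv; elim: k => [|k IH]; first by rewrite !mulr0n !addr0.
have kL : L1 (x + v *+ k) by apply: layerD xL _; exact: horizontalMn.
have [rk _] := rigid_horizontal hv xL kL.
rewrite mulrSr addrA mulrSr addrA -IH rk.
by rewrite subrKC.
Qed.

(** Distances are controlled only up to rounding to integers. Along k steps this reads k |v| <= k |A
    v| + 2, and the error disappears as k grows. *)
Lemma lp_norm_rigid x v : L1 x -> horizontal v ->
  lp_norm p v <= lp_norm p (F (x + v) - F x).
Proof.
move=> xL hv; rewrite -subr_le0; apply: (@le0_of_bounded_mulrn _ _ 2) => k.
set b := lp_norm p (F (x + v) - F x).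
have kL : L1 (x + v *+ k) by apply: layerD xL _; exact: horizontalMn.
pose K := Num.truncn (b *+ k).
have b0 : 0 <= b *+ k by rewrite mulrn_wge0// lp_norm_ge0.
have lpMn u : lp_norm p (u *+ k) = lp_norm p u *+ k.
  by rewrite -scaler_nat lp_normZ// ger0_norm ?ler0n// mulr_natl.
have := @lp_distF_inv K _ _ kL xL.
have -> : F (x + v *+ k) - F x = (F (x + v) - F x) *+ k.
  by rewrite (rigid_iter k xL hv) addrAC subrr add0r.
have -> : x + v *+ k - x = v *+ k by rewrite addrAC subrr add0r.
rewrite !lpMn => h.
have {}h : lp_norm p v *+ k <= K.+2%:R.
  by apply: h; rewrite (le_trans (ltW (truncnS_gt _)))// ler_nat.
rewrite mulrnBl lerBlDr addrC; apply: le_trans h _.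
by rewrite -addn2 natrD lerD2r /K truncn_le.
Qed.

Lemma vert_contract_near x y : L1 x -> L1 y -> lp_norm p (vert (x - y)) <= 1 ->
  lp_norm p (vert (F x - F y)) <= lp_norm p (vert (x - y)).
Proof.
have halves (q r s t : R) :
    q <= 2^-1 * r + (1 - 2^-1) * s -> r + t = 1 -> s + t = 1 -> q <= 1 - t by lra.
move=> xL yL.
move=> c_le1; have E1 := lp_norm_le1 hp (vert (x - y)); rewrite E1 in c_le1.
have E2 := lp_norm_le hp (vert (F x - F y)) (lp_norm_ge0 p (vert (x - y))).
rewrite E2 (abspow_lp_norm hp).
suff contract c : c = vert (x - y) -> sumpow p c <= 1 ->
  sumpow p (vert (F x - F y)) <= sumpow p c by exact: contract erefl c_le1.
move=> cE c1.
have [e [he e1]] := @horizontal_unit _ n m p hn hp.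
pose a := abspow p^-1 (1 - sumpow p c) *: e.
have ha : horizontal a by exact: horizontalZ.
have aE : sumpow p a = 1 - sumpow p c.
  rewrite sumpowZ (iffLR (lp_norm_eq1 hp _) e1) mulr1 abspowK// ger0_norm//.
  by rewrite subr_ge0.
pose h := x - y - c.
have hh : horizontal h by rewrite /h cE; exact: horizontalB_vert.
pose x0 := x - h.
(* Sliding x by the horizontal vector [h] makes the difference with y purely vertical, and by
   rigidity leaves the vertical part of F x - F y unchanged. *)
have x0L : L1 x0 by apply: layerD xL _; exact: horizontalN.
have x0y : x0 - y = c.
  by rewrite /x0 /h; rowfield.
have Fxy : vert (F x - F y) = vert (F x0 - F y).
  have x0h : x0 + h = x by rewrite /x0 subrK.
  have [_] := rigid_horizontal hh x0L x0L; rewrite x0h => /vert_horizontal hx.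
  have -> : F x - F y = (F x - F x0) + (F x0 - F y) by rewrite subrKA.
  by rewrite vertD hx add0r.
have dist1 z : horizontal z -> sumpow p z = sumpow p a ->
    lp_norm p (F (x0 + z) - F y) = 1.
  move=> hz za; apply: F1; [exact: layerD x0L hz|exact: yL|].
  rewrite addrAC x0y addrC; apply/(lp_norm_eq1 hp).
  by rewrite cE (sumpowD_vert _ p0 hz) -cE za aE subrK.
pose W := F x0 - F y; pose b := W - vert W; pose B := F (x0 + a) - F x0.
have hb : horizontal b by exact: horizontalB_vert.
have [_ hB] := rigid_horizontal ha x0L x0L.
(* Rigidity compares the displacements by a from x0 - a and from x0, which gives A (-a) = - A a. *)
have FN : F (x0 - a) - F x0 = - B.
  have aL : L1 (x0 - a) by apply: layerD x0L _; exact: horizontalN.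
  by have [+ _] := rigid_horizontal ha aL x0L; rewrite subrK /B => <-; rewrite opprB.
have bW : b + vert W = W by rewrite subrK.
have sP : sumpow p (b + B) + sumpow p (vert W) = 1.
  rewrite -(sumpowD_vert W p0 (horizontalD hb hB)); apply/(lp_norm_eq1 hp).
  rewrite addrAC bW addrC -[RHS](dist1 a ha erefl) /B /W.
  by rewrite subrKA.
have sN : sumpow p (B - b) + sumpow p (vert W) = 1.
  rewrite -opprB sumpowN -(sumpowD_vert W p0 (horizontalB hb hB)).
  apply/(lp_norm_eq1 hp).
  rewrite addrAC bW addrC -[RHS](dist1 (- a) (horizontalN ha) (sumpowN _ _)).
  by rewrite -FN /W subrKA.
(* B is the midpoint of b + B and B - b, whose p-th powers both equal 1 - |vert W|^p. *)
have sB : sumpow p B <= 1 - sumpow p (vert W).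
  have h2 : 0 < (2^-1 : R) < 1 by rewrite invr_gt0 ltr0n invf_lt1 ?ltr0n// ltr1n.
  have := sumpow_convex hp (b + B) (B - b) h2.
  by rewrite midpoint_reflections; move=> /halves; exact.
have aB := ler_sumpow hp (lp_norm_rigid x0L ha).
rewrite Fxy.
by move: (le_trans aB sB); rewrite aE lerD2l lerN2.
Qed.

(** The segment from y to x is cut into [K] pieces of vertical length at most 1; the local bound
    holds on each, and the triangle inequality adds them up. *)
Lemma vert_contract x y : L1 x -> L1 y ->
  lp_norm p (vert (F x - F y)) <= lp_norm p (vert (x - y)).
Proof.
move=> xL yL; set l := lp_norm p (vert (x - y)).
pose K := (Num.truncn l).+1.
have K0 : 0 < K%:R :> R by rewrite ltr0n.
have lK : l / K%:R <= 1 by rewrite ler_pdivrMr// mul1r ltW// truncnS_gt.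
pose z i := (i%:R / K%:R) *: x + (1 - i%:R / K%:R) *: y.
have zL i : (i <= K)%N -> L1 (z i).
  move=> iK; apply: layer_convex xL yL.
  by rewrite divr_ge0 ?ler0n//= ler_pdivrMr// mul1r ler_nat.
have step i : lp_norm p (vert (z i.+1 - z i)) = l / K%:R.
  have -> : z i.+1 - z i = K%:R^-1 *: (x - y).
    rewrite /z -natr1 mulrDl; move: (i%:R / K%:R) => r; rewrite mul1r; rowfield.
  by rewrite vertZ lp_normZ// gtr0_norm ?invr_gt0// mulrC.
have bound i : (i <= K)%N -> lp_norm p (vert (F (z i) - F y)) <= l / K%:R *+ i.
  elim: i => [_|i IH iK].
    by rewrite /z mul0r scale0r add0r subr0 scale1r subrr vert_horizontal ?lp_norm0//;
      exact: horizontal0.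
  rewrite -(subrKA (F (z i))) vertD mulrS.
  apply: le_trans (lp_normD hp _ _) (lerD _ (IH (ltnW iK))).
  by rewrite -(step i);
    apply: vert_contract_near; rewrite ?step//; apply: zL => //; exact: ltnW.
have zK : z K = x by rewrite /z divff ?gt_eqF// subrr scale0r addr0 scale1r.
by have := bound K (leqnn K); rewrite zK -[_ *+ K]mulr_natr divfK ?gt_eqF.
Qed.

Lemma width_le : (1 <= m)%N -> 0 < eps1 -> 0 < eps2 -> eps2 <= eps1.
Proof.
have absB (e s t : R) : 0 <= s <= e -> 0 <= t <= e -> `|s - t| <= e.
  by rewrite ler_norml => ? ?; apply/andP; split; lra.
move=> hm e1 e2; rewrite leNgt; apply/negP => e12.
(* The vertical parts of [t] and 0 are opposite corners of the cube of side [eps2]. Their preimages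
   differ by at most [eps1] in each vertical coordinate, against the contraction if [eps1 < eps2];
   [1 <= m] makes the sum comparison strict. *)
pose t : V := const_mx eps2.
have tL : L2 t by move=> j; rewrite mxE lexx ltW.
have oL : L2 0 by move=> j; rewrite mxE lexx ltW.
have := vert_contract (GL tL) (GL oL).
rewrite !GK// subr0 lp_norm_le ?lp_norm_ge0// abspow_lp_norm// !sumpow_vert//.
apply/negP; rewrite -ltNge.
apply: ltr_sum => [|j _];
  first by apply/hasP; exists (Ordinal hm); rewrite ?mem_index_enum.
rewrite [t _ _]mxE gt0_ltr_powR ?nnegrE ?normr_ge0//.
rewrite (gtr0_norm e2); apply: le_lt_trans e12.
rewrite 2!mxE; apply: absB; [exact: (GL tL j)|exact: (GL oL j)].
Qed.

End UnitPreserving.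

(** * From graph isomorphisms to maps of the ambient space *)

Lemma graph_isomorphic_sym (G H : graph) :
  graph_isomorphic G H -> graph_isomorphic H G.
Proof.
move=> [f [[g fK gK] fE]]; exists g; split; first by exists f.
by move=> x y; rewrite fE !gK.
Qed.

(** Totalizing the map, by the identity off [A], lets the geometry write F (x + v) without carrying
    membership proofs. *)
Definition extend (T : Type) (A B : set T) (f : A -> B) (x : T) : T :=
  if pselect (A x) is left Ax then \val (f (exist _ x (mem_set Ax))) else x.

Lemma extendE (T : Type) (A B : set T) (f : A -> B) (z : A) :
  extend f (\val z) = \val (f z).
Proof.
rewrite /extend; case: pselect => [Az|]; last by case; exact: set_valP.
by congr (\val (f _)); apply: val_inj.
Qed.

Lemma layer_graph_width_le (R : realType) (n m : nat) (p eps1 eps2 : R) :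
  (2 <= n)%N -> (1 <= m)%N -> 1 < p -> 0 < eps1 -> 0 < eps2 ->
  graph_isomorphic (layer_graph n m p eps1) (layer_graph n m p eps2) ->
  eps2 <= eps1.
Proof.
move=> hn hm hp e1 e2 [f [[g fK gK] fE]].
have lift eps x : layer n m eps x -> exists z : layer n m eps, \val z = x.
  by move=> xL; exists (exist _ x (mem_set xL)).
pose F := extend f; pose G := extend g.
have FL x : layer n m eps1 x -> layer n m eps2 (F x).
  by case/lift => z <-; rewrite /F extendE; exact: set_valP.
have GL x : layer n m eps2 x -> layer n m eps1 (G x).
  by case/lift => z <-; rewrite /G extendE; exact: set_valP.
have FK x : layer n m eps1 x -> G (F x) = x.
  by case/lift => z <-; rewrite /F /G !extendE fK.
have GK x : layer n m eps2 x -> F (G x) = x.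
  by case/lift => z <-; rewrite /F /G !extendE gK.
have F1 x y : layer n m eps1 x -> layer n m eps1 y ->
    lp_norm p (x - y) = 1 -> lp_norm p (F x - F y) = 1.
  move=> /lift[u <-] /lift[v <-]; rewrite /F !extendE; exact: (iffLR (fE u v)).
have G1 x y : layer n m eps2 x -> layer n m eps2 y ->
    lp_norm p (x - y) = 1 -> lp_norm p (G x - G y) = 1.
  move=> /lift[u <-] /lift[v <-]; rewrite /G !extendE => uv.
  by apply: (iffRL (fE (g u) (g v))); rewrite !gK.
exact: (width_le hn hp FL GL FK GK F1 G1 hm e1 e2).
Qed.

Theorem theorem2 (R : realType) (n m : nat) (p eps1 eps2 : R)
    (hn : (2 <= n)%N) (hm : (1 <= m)%N) (hp : 1 < p)
    (heps1 : 0 < eps1) (heps2 : 0 < eps2) :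
  graph_isomorphic (layer_graph n m p eps1) (layer_graph n m p eps2)
  <-> eps1 = eps2.
Proof.
split=> [iso|->]; last by exists id; split => //; exists id.
apply/eqP; rewrite eq_le; apply/andP; split.
  by apply: layer_graph_width_le (graph_isomorphic_sym iso).
exact: layer_graph_width_le iso.
Qed.
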